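(* Let $a$ be an integer with $a\ge 2$. If an edge-colored complete bipartite graph $K_{m,n}$ satisfies $\delta^c(K_{m,n})\ge a+2$, then $K_{m,n}$ admits an $(a,2)$-feasible partition, i.e. $V(K_{m,n})$ can be partitioned into two non-empty sets $A$ and $B$ such that $\delta^c(K_{m,n}[A])\ge a$ and $\delta^c(K_{m,n}[B])\ge 2$.
   Context: All graphs are finite and simple, and have non-empty vertex set. An edge-colored graph is a graph together with an arbitrary (not necessarily proper) assignment of a color to each edge. For a vertex $v$ of an edge-colored graph $G$, the color degree $d^c_G(v)$ is the number of distinct colors appearing on the edges of $G$ incident with $v$, and $\delta^c(G)=\min\{d^c_G(v): v\in V(G)\}$. $G[A]$ is the subgraph induced by $A$ with the inherited edge-coloring. *)

(* Defs.v *)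
From HB Require Import structures.
From mathcomp Require Import all_boot.

Set Implicit Arguments.
Unset Strict Implicit.
Unset Printing Implicit Defensive.

Record sgraph := SGraph {
  svertex :> finType;
  adj : rel svertex;
  adj_sym : symmetric adj;
  adj_irrefl : irreflexive adj }.

(* The color of an edge xy is [c [set x; y]]; values of [c] on sets that are  *)
(* not edges play no role.                                                    *)
Definition edge_coloring (G : sgraph) (C : eqType) := {set G} -> C.

Section Induced.
Variables (G : sgraph) (A : {set G}).

Definition induced_adj : rel {x : G | x \in A} :=
  fun x y => adj (val x) (val y).

Fact induced_adj_sym : symmetric induced_adj.
Proof. by move=> x y; apply: adj_sym. Qed.

Fact induced_adj_irrefl : irreflexive induced_adj.
Proof. by move=> x; apply: adj_irrefl. Qed.

Definition induced : sgraph := SGraph induced_adj_sym induced_adj_irrefl.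

Definition induced_coloring (C : eqType) (c : edge_coloring G C) :
    edge_coloring induced C :=
  fun e => c [set val x | x in e].

End Induced.

Section ColorDegree.
Variables (G : sgraph) (C : eqType) (c : edge_coloring G C).

Definition incident_colors (v : G) : seq C :=
  [seq c [set v; w] | w in adj v].

Definition color_degree (v : G) : nat := size (undup (incident_colors v)).

Lemma color_degree_le (v : G) : color_degree v <= #|G|.
Proof.
apply: leq_trans (size_undup _) _.
by rewrite size_image max_card.
Qed.

(* The default value #|G| bounds every color degree, so this is the minimum   *)
(* color degree as soon as G has a vertex; it is 0 on the empty graph.        *)
Definition min_color_degree : nat := \big[minn/#|G|]_(v : G) color_degree v.

Lemma leq_min_color_degree (k : nat) : 0 < #|G| ->
  k <= min_color_degree <-> forall v, k <= color_degree v.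
Proof.
move=> /card_gt0P[v0 _]; rewrite /min_color_degree; split=> [le_k v|le_k].
  apply: leq_trans le_k _; have := mem_index_enum v.
  elim: (index_enum _) => //= w s IHs; rewrite inE big_cons geq_min.
  by case/predU1P=> [<-|/IHs ->]; rewrite ?leqnn ?orbT.
elim/big_ind: _ => [|x y kx ky|v _]; last exact: le_k.
  exact: leq_trans (le_k v0) (color_degree_le v0).
by rewrite leq_min kx.
Qed.

End ColorDegree.

Definition has_feasible_partition (G : sgraph) (C : eqType)
    (c : edge_coloring G C) (a b : nat) : Prop :=
  exists A B : {set G},
    [/\ A != set0, B != set0, A :|: B = [set: G] & [disjoint A & B]] /\
    a <= min_color_degree (induced_coloring (A := A) c) /\
    b <= min_color_degree (induced_coloring (A := B) c).

Section CompleteBipartite.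
Variables m n : nat.

Definition complete_bipartite_adj : rel ('I_m + 'I_n) :=
  fun x y => match x, y with
    | inl _, inr _ | inr _, inl _ => true
    | _, _ => false
    end.

Fact complete_bipartite_adj_sym : symmetric complete_bipartite_adj.
Proof. by case=> i [] j. Qed.

Fact complete_bipartite_adj_irrefl : irreflexive complete_bipartite_adj.
Proof. by case. Qed.

Definition complete_bipartite : sgraph :=
  SGraph complete_bipartite_adj_sym complete_bipartite_adj_irrefl.

End CompleteBipartite.

(* Main.v *)
Require Import Defs.
From HB Require Import structures.
From mathcomp Require Import all_boot.

(** A properly colored 4-cycle B leaves the color degrees of all other vertices
    almost intact: a vertex outside B has at most two neighbors in B, because it
    is adjacent only to the two vertices of B on the other side, and so it loses
    at most two colors. As the color degrees are at least [a + 2], the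
    partition into B and its complement is feasible as soon as a properly
    colored 4-cycle exists ([proper_C4_feasible_partition]).

    Its existence already follows from color degree 2 on one side and 3 on the
    other, and is a statement on matrices ([proper_square_exists]): if every row
    has two values and every column three, then some 2 x 2 submatrix has no two
    equal adjacent entries. Otherwise take a row u and a value alpha whose class
    K (the columns where u takes the value alpha) is as large as possible. By
    maximality alpha does not occur outside of the columns K. Comparing any row
    z with a row t that is constantly alpha on K shows that, for w outside K,
    either z agrees with t at w or z takes on K no other values than alpha and
    z(w). Choose t and w such that some row that is not constantly alpha on K
    disagrees with t at w. The rows that do so have nested supports (columns of
    K where the value is not alpha), and by maximality none of these supports is
    the whole of K; so some column of K is alpha on all of them. The remaining
    rows can only contribute the value t(w) to that column, which thus has at
    most two values, a contradiction. *)

(** * Submatrices without equal adjacent entries *)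

Section ProperSquare.
Variables (I J : finType) (C : eqType) (M : I -> J -> C).

(** If rows and columns are the two sides of a complete bipartite graph and
    entries are the colors of its edges, then this is a properly colored
    4-cycle. *)
Definition proper_square (i i' : I) (j j' : J) : bool :=
  [&& M i j != M i j', M i' j != M i' j', M i j != M i' j & M i j' != M i' j'].

Let row_class i x := [set j | M i j == x].

(** Without proper squares, a largest class K of equal entries in a row contains
    a column with at most two values. *)
Lemma proper_square_exists (i0 : I) (j0 : J) :
    (forall i x, exists j, M i j != x) ->
    (forall j x y, exists i, (M i j != x) && (M i j != y)) ->
  exists i i' j j', proper_square i i' j j'.
Proof.
move=> row2 col3.
have [/existsP[i /existsP[i' /existsP[j /existsP[j' sq]]]]|no_sq] :=
  boolP [exists i, exists i', exists j, exists j', proper_square i i' j j'].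
  by exists i, i', j, j'.
exfalso.
have nosq i i' j j' : M i j != M i j' -> M i' j != M i' j' ->
    M i j != M i' j -> M i j' != M i' j' -> False.
  move=> h1 h2 h3 h4; case/existsP: no_sq; exists i.
  apply/existsP; exists i'; apply/existsP; exists j; apply/existsP; exists j'.
  by rewrite /proper_square h1 h2 h3 h4.
have [[u k0] _ max_uk] :=
  @arg_maxnP _ (i0, j0) predT (fun p => #|row_class p.1 (M p.1 p.2)|) isT.
set alpha := M u k0 in max_uk; pose K := row_class u alpha.
have no_larger i w : w \notin K -> ~ (forall k, k \in K -> M i k = M i w).
  move=> wK Kw; have := max_uk (i, w) isT; apply/negP; rewrite -ltnNge /=.
  apply/proper_card/properP; split; last by exists w; rewrite // inE.
  by apply/subsetP=> k /Kw eq_kw; rewrite inE eq_kw.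
have alphaK k : k \in K -> M u k = alpha by rewrite inE => /eqP.
have no_alpha i w : w \notin K -> M i w != alpha.
  move=> wK; apply/negP=> /eqP iw; apply: (no_larger i w wK) => k kK.
  apply/eqP/negPn/negP=> ikw; apply: (nosq u i k w) => //.
  - by rewrite alphaK // eq_sym; rewrite inE in wK.
  - by rewrite alphaK // -iw eq_sym.
  - by rewrite iw; rewrite inE in wK.
pose T := [set t | [forall k in K, M t k == alpha]].
have constT t k : t \in T -> k \in K -> M t k = alpha.
  by rewrite inE => /forall_inP tT /tT /eqP.
(* Otherwise the rows t, z and the columns k, w form a proper square. *)
have agree t z k w : t \in T -> k \in K -> w \notin K ->
    M z k != alpha -> M z w != M t w -> M z w = M z k.
  move=> tT kK wK zk zw; apply/eqP/negPn/negP=> zwk; apply: (nosq t z k w).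
  - by rewrite (constT t k) // eq_sym no_alpha.
  - by rewrite eq_sym.
  - by rewrite (constT t k) // eq_sym.
  - by rewrite eq_sym.
have uT : u \in T by rewrite inE; apply/forall_inP=> k /alphaK ->.
have [w _ wK] : exists2 w, true & w \notin K.
  by have [w] := row2 u alpha; exists w; rewrite // inE.
(* If all rows outside T agree with u at w, then u is replaced by a row of T
   that differs from u at w. *)
have [t tT [z0 z0T z0w]] :
    exists2 t, t \in T & exists2 z, z \notin T & M z w != M t w.
  have [r rw] : exists r, M r w != M u w.
    by have [r /andP[]] := col3 w (M u w) (M u w); exists r.
  have [rT|rT] := boolP (r \in T); last by exists u => //; exists r.
  have [z /andP[zk _]] := col3 k0 alpha alpha.
  have zT : z \notin T.
    by apply: contra zk => zT; apply/eqP/constT; last by rewrite inE.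
  have [zw|zw] := eqVneq (M z w) (M u w); last by exists u => //; exists z.
  by exists r => //; exists z => //; rewrite zw eq_sym.
(* The rows in P have pairwise nested supports; z has the largest one. *)
pose P z := (z \notin T) && (M z w != M t w).
pose supp z := [set k in K | M z k != alpha].
have suppE z k : P z -> k \in supp z -> M z k = M z w.
  by case/andP=> _ zw; rewrite inE => /andP[kK zk]; rewrite (agree t z k w).
have [|z Pz max_z] := @arg_maxnP _ z0 P (fun z => #|supp z|); first exact/andP.
(* Otherwise the class of M z w in row z contains K and w, and exceeds K. *)
have [k kK kz] : exists2 k, k \in K & M z k = alpha.
  have [/exists_inP[k kK /eqP zk]|] := boolP [exists k in K, M z k == alpha].
    by exists k.
  rewrite negb_exists_in => /forall_inP nz; case: (no_larger z w wK) => k kK.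
  by apply: suppE => //; rewrite inE kK nz.
have [r /andP[rk rk_t]] := col3 k alpha (M t w).
have zw_alpha := no_alpha z w wK.
have /andP[_ zwt] := Pz.
have [rw|rw] := eqVneq (M r w) (M t w).
  (* Here r is not in P, and its entry t(w) at w forms a square with z. *)
  apply: (nosq z r k w); rewrite ?kz ?rw //; by rewrite eq_sym.
(* Here r is in P, and its support is not contained in that of z. *)
have Pr : P r.
  by rewrite /P rw andbT; apply: contra rk => rT; rewrite constT.
have k_r : k \in supp r by rewrite inE kK.
have /subsetPn[k' k'z k'r] : ~~ (supp z \subset supp r).
  apply/negP=> sub; have := max_z r Pr; apply/negP; rewrite -ltnNge.
  apply/proper_card/properP; split=> //; exists k => //.
  by rewrite inE kz eqxx andbF.
have zk' := suppE z k' Pz k'z.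
have k'K : k' \in K by move: k'z; rewrite inE => /andP[].
have rk' : M r k' = alpha.
  by apply/eqP; move: k'r; rewrite inE k'K /= negbK.
apply: (nosq z r k k'); rewrite ?kz ?zk' ?rk' //; by rewrite eq_sym.
Qed.
End ProperSquare.

(** * Color degrees *)

Section ColorDegreeTheory.
Variables (G : sgraph) (C : eqType) (c : edge_coloring G C).

Lemma incident_colorsP (v : G) x :
  reflect (exists2 w, adj v w & x = c [set v; w]) (x \in incident_colors c v).
Proof. exact: imageP. Qed.

Lemma avoiding_neighbor (v : G) (s : seq C) : size s < color_degree c v ->
  exists2 w, adj v w & c [set v; w] \notin s.
Proof.
move=> lt_s; have [|sub] := boolP (all (mem s) (undup (incident_colors c v))).
  move/allP=> sub; have := uniq_leq_size (undup_uniq _) sub.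
  by rewrite leqNgt lt_s.
case/allPn: sub => x; rewrite mem_undup => /incident_colorsP[w vw ->] /= ws.
by exists w.
Qed.

Lemma color_degree_gt1 (v x y : G) : adj v x -> adj v y ->
  c [set v; x] != c [set v; y] -> 1 < color_degree c v.
Proof.
move=> vx vy xy.
apply: (@uniq_leq_size _ [:: c [set v; x]; c [set v; y]]).
  by rewrite /= inE xy.
move=> d; rewrite !inE mem_undup => /orP[]/eqP->; apply/incident_colorsP.
  by exists x.
by exists y.
Qed.

Lemma induced_coloring_edge (A : {set G}) (v w : induced A) :
  induced_coloring (A := A) c [set v; w] = c [set val v; val w].
Proof. by rewrite /induced_coloring imsetU1 imset_set1. Qed.

(** A color lost at v in G[A] is carried by an edge leaving A. *)
Lemma color_degree_induced (A : {set G}) (v : induced A) :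
  color_degree c (val v) <=
    color_degree (induced_coloring (A := A) c) v
    + #|[set w in ~: A | adj (val v) w]|.
Proof.
set N := [set w in _ | _].
rewrite /color_degree cardE -(size_map (fun w => c [set val v; w])) -size_cat.
apply: uniq_leq_size (undup_uniq _) _ => x.
rewrite mem_undup => /incident_colorsP[w vw ->]; rewrite mem_cat mem_undup.
have [wA|wA] := boolP (w \in A).
  apply/orP; left; apply/imageP; exists (exist _ w wA) => //.
  by rewrite induced_coloring_edge.
by apply/orP; right; apply: map_f; rewrite mem_enum !inE wA.
Qed.

End ColorDegreeTheory.

(** * Complete bipartite graphs *)

Section CompleteBipartiteColoring.
Variables (m n : nat) (C : eqType).
Let G := complete_bipartite m n.
Variable c : edge_coloring G C.

Let color i j := c [set (inl i : G); inr j].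

Lemma proper_C4_exists : 0 < #|G| -> (forall v, 2 < color_degree c v) ->
  exists i i' j j', proper_square _ _ _ color i i' j j'.
Proof.
move=> G_gt0 deg3.
have row (i : 'I_m) s : size s <= 2 -> exists j, color i j \notin s.
  move=> s2.
  have := avoiding_neighbor _ _ c _ _ (leq_ltn_trans s2 (deg3 (inl i))).
  by case=> [[i'|j] //= _]; exists j.
have col (j : 'I_n) s : size s <= 2 -> exists i, color i j \notin s.
  move=> s2.
  have := avoiding_neighbor _ _ c _ _ (leq_ltn_trans s2 (deg3 (inr j))).
  by case=> [[i|j'] //= _]; rewrite setUC; exists i.
have [i0 [j0 _]] : exists i : 'I_m, exists j : 'I_n, true.
  have /card_gt0P[[i|j] _] := G_gt0.
    by have [j _] := row i [::] isT; exists i, j.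
  by have [i _] := col j [::] isT; exists i, j.
apply: (proper_square_exists _ _ _ color i0 j0) => [i x|j x y].
  by have [j] := row i [:: x] isT; rewrite inE; exists j.
by have [i] := col j [:: x; y] isT; rewrite !inE negb_or; exists i.
Qed.

(** The partition consists of the 4-cycle and its complement. The vertices of
    the cycle have color degree 2 in it, and every other vertex has at most two
    neighbors on it. *)
Lemma proper_C4_feasible_partition (a : nat) i i' j j' :
    proper_square _ _ _ color i i' j j' -> 1 < a ->
    (forall v, a + 2 <= color_degree c v) ->
  has_feasible_partition c a 2.
Proof.
case/and4P=> ij_ij' i'j_i'j' ij_i'j ij'_i'j' a_gt1 deg_c.
pose left_pair : {set G} := [set inl i; inl i'].
pose right_pair : {set G} := [set inr j; inr j'].
pose B := left_pair :|: right_pair.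
have min_degree (A : {set G}) d : A != set0 ->
    (forall v : induced A, d <= color_degree (induced_coloring (A := A) c) v) ->
    d <= min_color_degree (induced_coloring (A := A) c).
  case/set0Pn=> x xA; apply: (proj2 (leq_min_color_degree _ _ _)).
  by apply/card_gt0P; exists (exist _ x xA).
have B0 : B != set0 by apply/set0Pn; exists (inl i); rewrite !inE eqxx.
have A0 : ~: B != set0.
  (* A neighbor of i joined to it by a third color is not on the cycle. *)
  have [|[k|k] // _] :=
    avoiding_neighbor _ _ c (inl i) [:: color i j; color i j'].
    by apply: leq_trans (deg_c _); rewrite addn2 !ltnS ltnW.
  rewrite !inE negb_or => /andP[kj kj'].
  apply/set0Pn; exists (inr k); rewrite !inE /=.
  by rewrite negb_or; apply/andP; split; [move: kj | move: kj'];
    apply: contra => /eqP[->].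
exists (~: B), B; split; last split.
- split; [exact: A0 | exact: B0 | by rewrite setUC setUCr |].
  by rewrite -setI_eq0 setIC setICr.
- apply: (min_degree _ _ A0) => v; rewrite -(leq_add2r 2).
  apply: leq_trans (deg_c (val v)) _.
  apply: leq_trans (color_degree_induced _ _ c _ v) _; rewrite leq_add2l setCK.
  have [sub|sub] : [set w in B | adj (val v) w] \subset left_pair \/
      [set w in B | adj (val v) w] \subset right_pair.
  + case: (val v) => k; [right | left]; apply/subsetP=> -[l|l];
      by rewrite !inE /= ?andbF ?andbT ?orbF.
  + by apply: leq_trans (subset_leq_card sub) _; rewrite cards2; case: (_ != _).
  + by apply: leq_trans (subset_leq_card sub) _; rewrite cards2; case: (_ != _).
- apply: (min_degree _ _ B0) => -[v vB].
  have [[Bi Bi'] [Bj Bj']] :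
      (inl i \in B /\ inl i' \in B) /\ (inr j \in B /\ inr j' \in B).
    by split; split; rewrite !inE eqxx ?orbT.
  pose x1 : induced B := exist _ (inl i) Bi.
  pose x2 : induced B := exist _ (inl i') Bi'.
  pose y1 : induced B := exist _ (inr j) Bj.
  pose y2 : induced B := exist _ (inr j') Bj'.
  case: v vB => k vB; have := vB; rewrite !inE /= ?orbF => /orP[]/eqP kE.
  + apply: (color_degree_gt1 _ _ _ _ y1 y2) => //.
    by rewrite !induced_coloring_edge /= kE.
  + apply: (color_degree_gt1 _ _ _ _ y1 y2) => //.
    by rewrite !induced_coloring_edge /= kE.
  + apply: (color_degree_gt1 _ _ _ _ x1 x2) => //.
    by rewrite !induced_coloring_edge /= kE ![[set inr j; _]]setUC.
  + apply: (color_degree_gt1 _ _ _ _ x1 x2) => //.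
    by rewrite !induced_coloring_edge /= kE ![[set inr j'; _]]setUC.
Qed.

End CompleteBipartiteColoring.

Theorem theorem1p6 (a m n : nat) (C : eqType)
    (c : edge_coloring (complete_bipartite m n) C) :
  2 <= a -> a + 2 <= min_color_degree c -> has_feasible_partition c a 2.
Proof.
move=> a_ge2 deg_c.
have G_gt0 : 0 < #|complete_bipartite m n|.
  (* Without vertices the minimum would be its default value 0. *)
  rewrite lt0n; apply/eqP=> G0; move: deg_c; rewrite /min_color_degree.
  rewrite big_pred0 => [|v]; first by rewrite G0 addn2.
  by have := card0_eq G0 v; rewrite inE.
have {}deg_c v : a + 2 <= color_degree c v.
  by move: v; apply/leq_min_color_degree.
have [v|i [i' [j [j' sq]]]] := proper_C4_exists _ _ _ c G_gt0.
  by apply: leq_trans (deg_c v); rewrite addn2 !ltnS ltnW.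
exact: proper_C4_feasible_partition sq a_ge2 deg_c.
Qed.
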